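(* Let $M$ and $N$ be two quasianalytic weight sequences and assume $\lim_{k\to+\infty}n_k^{1/k}=+\infty$ (i.e. $\mathcal O^{0,r}\subsetneq\mathcal E^{0,r}_{(N)}$). Then $j^\infty(\mathcal E^{0,r}_{\{M\}})\cap\Lambda^r_{(N)}$ is meager in the Fréchet space $\Lambda^r_{(N)}$, i.e. $\Lambda^r_{(N)}\setminus j^\infty(\mathcal E^{0,r}_{\{M\}})$ contains a countable intersection of dense open subsets of $\Lambda^r_{(N)}$. In particular $\Lambda^r_{(N)}\setminus j^\infty(\mathcal E^{0,r}_{\{M\}})$ is dense in $\Lambda^r_{(N)}$.
   Context: For a sequence $M=(M_p)_{p\in\mathbb N}$ of positive reals write $m_p:=M_p/p!$ (and $n_p:=N_p/p!$). $M$ is a weight sequence if $1=M_0\le M_1$, $M_p^2\le M_{p-1}M_{p+1}$ for all $p\ge1$, and $\liminf_{p\to\infty}m_p^{1/p}>0$; it is quasianalytic if $\sum_{p\ge1}M_{p-1}/M_p=+\infty$. For $U\subseteq\mathbb R^r$ open, $K\subseteq U$ compact, $h>0$: $\|f\|^M_{K,h}:=\sup_{\alpha\in\mathbb N^r,x\in K}|\partial^\alpha f(x)|/(h^{|\alpha|}M_{|\alpha|})$. $\mathcal E_{\{M\}}(U)$ consists of smooth $f$ such that for every compact $K\subseteq U$ there exists $h>0$ with $\|f\|^M_{K,h}<\infty$; $\mathcal E_{(M)}(U)$: for every compact $K$ and every $h>0$. $\mathcal E^{0,r}_{\{M\}}$, $\mathcal E^{0,r}_{(M)}$ are the spaces of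 germs at $0\in\mathbb R^r$ of functions in the respective class on some cube $(-1/k,1/k)^r$; $\mathcal O^{0,r}$ denotes germs at $0$ of real analytic functions. For $\mathbf b=(b_\alpha)_{\alpha\in\mathbb N^r}$ and $h>0$: $|\mathbf b|^N_h:=\sup_\alpha|b_\alpha|/(h^{|\alpha|}n_{|\alpha|})$; $\Lambda^r_{(N)}:=\{\mathbf b:\forall h>0,|\mathbf b|^N_h<\infty\}$, a Fréchet space with the seminorms $|\cdot|^N_h$, $h>0$. The Borel map is $j^\infty(f)=(\partial^\alpha f(0)/|\alpha|!)_{\alpha\in\mathbb N^r}$. A subset of a Baire space is meager if its complement contains a countable intersection of dense open sets. *)

(* Defs.v *)
From Stdlib Require Import Reals Lra Lia List Factorial.
Open Scope R_scope.

(* Points of R^r are represented as x : nat -> R with x i = 0 for i >= r. *)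
Definition IsPt (r : nat) (x : nat -> R) : Prop :=
  forall i, (r <= i)%nat -> x i = 0.

Definition upd (x : nat -> R) (i : nat) (t : R) : nat -> R :=
  fun j => if Nat.eqb j i then t else x j.

Definition OpenR (r : nat) (U : (nat -> R) -> Prop) : Prop :=
  forall x, U x -> IsPt r x /\
    exists d, 0 < d /\ forall y, IsPt r y ->
      (forall i, (i < r)%nat -> Rabs (y i - x i) < d) -> U y.

Definition CompactR (r : nat) (K : (nat -> R) -> Prop) : Prop :=
  (forall x, K x -> IsPt r x) /\
  forall (I : Type) (O : I -> (nat -> R) -> Prop),
    (forall i, OpenR r (O i)) ->
    (forall x, K x -> exists i, O i x) ->
    exists l : list I, forall x, K x -> exists i, In i l /\ O i x.

Definition Cube (r k : nat) (x : nat -> R) : Prop :=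
  IsPt r x /\ forall i, (i < r)%nat -> Rabs (x i) < / INR k.

(* f is smooth on U, D l being the iterated partial derivative
   d_{i1} ... d_{ik} f for l = [i1; ...; ik]; all are continuous on U. *)
Definition Smooth (r : nat) (U : (nat -> R) -> Prop) (f : (nat -> R) -> R)
  (D : list nat -> (nat -> R) -> R) : Prop :=
  (forall x, U x -> D nil x = f x) /\
  (forall l i x, Forall (fun j => (j < r)%nat) l -> (i < r)%nat -> U x ->
     derivable_pt_lim (fun t => D l (upd x i t)) (x i) (D (i :: l) x)) /\
  (forall l x eps, Forall (fun j => (j < r)%nat) l -> U x -> 0 < eps ->
     exists d, 0 < d /\ forall y, U y ->
       (forall i, (i < r)%nat -> Rabs (y i - x i) < d) ->
       Rabs (D l y - D l x) < eps).

Definition MultiIdx (r : nat) (a : nat -> nat) : Prop :=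
  forall i, (r <= i)%nat -> a i = 0%nat.

Fixpoint absM (r : nat) (a : nat -> nat) : nat :=
  match r with 0 => 0%nat | S r' => (absM r' a + a r')%nat end.

Fixpoint word (r : nat) (a : nat -> nat) : list nat :=
  match r with 0 => nil | S r' => word r' a ++ repeat r' (a r') end.

Definition Pderiv (D : list nat -> (nat -> R) -> R) (r : nat) (a : nat -> nat)
  : (nat -> R) -> R := D (word r a).

Definition small (M : nat -> R) (p : nat) : R := M p / INR (fact p).

Definition WeightSeq (M : nat -> R) : Prop :=
  (forall p, 0 < M p) /\ M 0%nat = 1 /\ M 0%nat <= M 1%nat /\
  (forall p, (1 <= p)%nat -> (M p) ^ 2 <= M (p - 1)%nat * M (p + 1)%nat) /\
  (exists c, 0 < c /\ exists P, forall p, (1 <= p)%nat -> (P <= p)%nat ->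
      c <= Rpower (small M p) (/ INR p)).

Definition Quasianalytic (M : nat -> R) : Prop :=
  forall B, exists n, B < sum_f_R0 (fun p => M p / M (S p)) n.

Definition RoumieuClass (r : nat) (M : nat -> R) (U : (nat -> R) -> Prop)
  (f : (nat -> R) -> R) (D : list nat -> (nat -> R) -> R) : Prop :=
  Smooth r U f D /\
  forall K, CompactR r K -> (forall x, K x -> U x) ->
    exists h, 0 < h /\ exists C, forall a x, MultiIdx r a -> K x ->
      Rabs (Pderiv D r a x) <= C * (h ^ absM r a * M (absM r a)).

Definition MSeq := (nat -> nat) -> R.

Definition InLambda (r : nat) (N : nat -> R) (b : MSeq) : Prop :=
  forall h, 0 < h -> exists C, forall a, MultiIdx r a ->
    Rabs (b a) <= C * (h ^ absM r a * small N (absM r a)).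

Definition Ball (r : nat) (N : nat -> R) (b : MSeq) (h eps : R) (c : MSeq) : Prop :=
  forall a, MultiIdx r a ->
    Rabs (c a - b a) <= eps * (h ^ absM r a * small N (absM r a)).

Definition LOpen (r : nat) (N : nat -> R) (O : MSeq -> Prop) : Prop :=
  forall b, InLambda r N b -> O b ->
    exists h eps, 0 < h /\ 0 < eps /\
      forall c, InLambda r N c -> Ball r N b h eps c -> O c.

Definition LDense (r : nat) (N : nat -> R) (O : MSeq -> Prop) : Prop :=
  forall b, InLambda r N b -> forall h eps, 0 < h -> 0 < eps ->
    exists c, InLambda r N c /\ O c /\ Ball r N b h eps c.

Definition BorelImageRoumieu (r : nat) (M : nat -> R) (b : MSeq) : Prop :=
  exists (k : nat) f D, (1 <= k)%nat /\ RoumieuClass r M (Cube r k) f D /\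
    forall a, MultiIdx r a ->
      b a = Pderiv D r a (fun _ => 0) / INR (fact (absM r a)).

(* Main.v *)
(** Restricting a germ to the first coordinate axis reduces to one variable: the
    image is covered by the sets [A_n] of sequences whose axis part is the jet
    of some [F] on [[0, 1/n]] with [|F^(j)| <= n n^j M_j], and [O_n] is the
    interior of the complement of [A_n]. A quantitative form of Bang's proof of
    the Denjoy-Carleman theorem says that a function obeying such bounds is
    small at [1/n] as soon as finitely many of its derivatives at [0] are small.
    Hence if [b] and [b + s x^p] were both in the closure of [A_n], then
    [s n^(-p)] would be bounded by a constant depending only on [n]; with
    [s = eps h^p n_p] this fails for large [p] because [n_p^(1/p)] tends to
    infinity. So [O_n] is dense, and the last assertion is Baire's theorem. *)

Require Import Defs.
From Stdlib Require Import Reals Lra Lia List Arith.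
From Stdlib Require Import Classical ClassicalEpsilon FunctionalExtensionality.
Open Scope R_scope.

(** * Elementary real analysis *)

Lemma finite_pos_lower_bound (g : nat -> R) (n : nat) :
  (forall j, 0 < g j) -> exists m, 0 < m /\ forall j, (j <= n)%nat -> m <= g j.
Proof.
  intros Hg. induction n as [|n [m [Hm IH]]].
  - exists (g 0%nat). split; [apply Hg|]. intros j Hj. replace j with 0%nat by lia. lra.
  - exists (Rmin m (g (S n))). split; [now apply Rmin_glb_lt|].
    intros j Hj. destruct (Nat.eq_dec j (S n)) as [->|Hne]; [apply Rmin_r|].
    apply Rle_trans with m; [apply Rmin_l|]. apply IH. lia.
Qed.

(** The mean value theorem applied to [g - f] and [g + f], whose derivatives are nonnegative, bounds
    the increment without integrating [f']. *)
Lemma derivative_dominated_increment (f f' g g' : R -> R) (a b : R) :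
  a <= b ->
  (forall y, a <= y <= b -> derivable_pt_lim f y (f' y)) ->
  (forall y, a <= y <= b -> derivable_pt_lim g y (g' y)) ->
  (forall y, a <= y <= b -> Rabs (f' y) <= g' y) ->
  Rabs (f b - f a) <= g b - g a.
Proof.
  intros Hab Hf Hg Hle.
  destruct (Req_dec a b) as [->|Hne].
  { unfold Rminus. rewrite !Rplus_opp_r, Rabs_R0. lra. }
  assert (Hlt : a < b) by lra.
  destruct (MVT_cor2 (fun y => g y - f y) (fun y => g' y - f' y) a b Hlt)
    as [c [Hc Hc']].
  { intros y Hy. apply derivable_pt_lim_minus; auto. }
  destruct (MVT_cor2 (fun y => g y + f y) (fun y => g' y + f' y) a b Hlt)
    as [d [Hd Hd']].
  { intros y Hy. apply derivable_pt_lim_plus; auto. }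
  assert (H1 := Hle c ltac:(lra)). assert (H2 := Hle d ltac:(lra)).
  assert (0 <= g' c - f' c) by (revert H1; unfold Rabs; destruct Rcase_abs; lra).
  assert (0 <= g' d + f' d) by (revert H2; unfold Rabs; destruct Rcase_abs; lra).
  apply Rabs_le. nra.
Qed.

(** * Bang's estimate *)

Definition LogConvex (W : nat -> R) : Prop :=
  forall p, W (S p) * W (S p) <= W p * W (S (S p)).

Lemma log_convex_ratio (W : nat -> R) :
  (forall p, 0 < W p) -> LogConvex W ->
  forall p d, W (S p) / W p <= W (S (p + d)) / W (p + d)%nat.
Proof.
  intros Hpos Hlc p d. induction d as [|d IH].
  - rewrite Nat.add_0_r. lra.
  - apply Rle_trans with (1 := IH). rewrite Nat.add_succ_r.
    assert (H := Hlc (p + d)%nat).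
    assert (H0 := Hpos (p + d)%nat). assert (H1 := Hpos (S (p + d))).
    apply Rmult_le_reg_r with (W (p + d)%nat * W (S (p + d))); [nra|].
    field_simplify; nra.
Qed.

(* Descending induction on [j], integrating the bound for [F (S j)]; this
   replaces Taylor's formula in Bang's argument. *)
Lemma bang_exp_bound (W : nat -> R) (F : nat -> R -> R) (A x y : R) (n : nat) :
  (forall p, 0 < W p) -> LogConvex W -> 0 <= A -> x <= y ->
  (forall j z, x <= z <= y -> derivable_pt_lim (F j) z (F (S j) z)) ->
  (forall j z, x <= z <= y -> Rabs (F j z) <= A * W j) ->
  (forall j, Rabs (F j x) <= A * exp (INR j - INR (S n)) * W j) ->
  forall d j z, (j + d = S n)%nat -> x <= z <= y ->
    Rabs (F j z) <= A * exp (INR j - INR (S n)) * W j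
                    * exp (exp 1 * (W (S n) / W n) * (z - x)).
Proof.
  intros Hpos Hlc HA Hxy HD HB H0. set (mu := exp 1 * (W (S n) / W n)).
  assert (Hmu : 0 < mu).
  { apply Rmult_lt_0_compat; [apply exp_pos|]. now apply Rdiv_lt_0_compat. }
  assert (Hexp1 : forall z, x <= z -> 1 <= exp (mu * (z - x))).
  { intros z Hz. rewrite <- exp_0 at 1.
    destruct (Req_dec x z) as [->|]; [right; f_equal; ring|].
    left. apply exp_increasing. nra. }
  induction d as [|d IH]; intros j z Hj Hz.
  - replace j with (S n) by lia. rewrite Rminus_diag, exp_0.
    assert (H := HB (S n) z Hz). assert (H1 := Hexp1 z ltac:(lra)).
    assert (0 <= A * W (S n)) by (apply Rmult_le_pos; [lra|left; apply Hpos]). nra.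
  - set (c := A * exp (INR j - INR (S n)) * W j).
    set (c1 := A * exp (INR (S j) - INR (S n)) * W (S j)).
    (* Passing from [j] to [S j] gains a factor [exp 1] from the exponential and at most
       [W (S n) / W n] from the weights, by log-convexity; their product is [mu]. *)
    assert (Hc1 : c1 <= mu * c).
    { unfold c1, c, mu.
      replace (INR (S j) - INR (S n)) with (1 + (INR j - INR (S n)))
        by (rewrite (S_INR j); ring).
      rewrite exp_plus.
      assert (Hr := log_convex_ratio W Hpos Hlc j d).
      replace (j + d)%nat with n in Hr by lia.
      assert (Hj0 := Hpos j).
      assert (Hr' : W (S j) <= W (S n) / W n * W j).
      { apply Rmult_le_reg_r with (/ W j); [now apply Rinv_0_lt_compat|].
        replace (W (S n) / W n * W j * / W j) with (W (S n) / W n)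
          by (field; split; apply Rgt_not_eq, Hpos). exact Hr. }
      assert (0 <= A * (exp 1 * exp (INR j - INR (S n)))).
      { apply Rmult_le_pos; [lra|]. left. apply Rmult_lt_0_compat; apply exp_pos. }
      nra. }
    assert (Hinc : Rabs (F j z - F j x)
              <= c1 / mu * exp (mu * (z - x)) - c1 / mu * exp (mu * (x - x))).
    { apply (derivative_dominated_increment (F j) (F (S j))
               (fun w => c1 / mu * exp (mu * (w - x)))
               (fun w => c1 * exp (mu * (w - x)))).
      - lra.
      - intros w Hw. apply HD. lra.
      - intros w Hw.
        replace (c1 * exp (mu * (w - x)))
          with (c1 / mu * (exp (mu * (w - x)) * (mu * (1 - 0)))) by (field; lra).
        apply (derivable_pt_lim_scal (fun w => exp (mu * (w - x)))).
        apply (derivable_pt_lim_comp (fun w => mu * (w - x)) exp).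
        + apply (derivable_pt_lim_scal (fun w => w - x)).
          apply (derivable_pt_lim_minus (fun w => w) (fun _ => x)).
          * apply derivable_pt_lim_id.
          * apply derivable_pt_lim_const.
        + apply derivable_pt_lim_exp.
      - intros w Hw. apply (IH (S j) w); [lia|lra]. }
    rewrite Rminus_diag, Rmult_0_r, exp_0 in Hinc.
    (* The increment is thus at most [c * (exp (mu * (z - x)) - 1)], and the bound [c] at [x]
       absorbs the [-1]. *)
    assert (Hq : c1 / mu <= c).
    { apply Rmult_le_reg_r with mu; [lra|].
      replace (c1 / mu * mu) with c1 by (field; lra). lra. }
    assert (Hx := H0 j). fold c in Hx. assert (He := Hexp1 z ltac:(lra)).
    assert (Ht : Rabs (F j z) <= Rabs (F j z - F j x) + Rabs (F j x)).
    { replace (F j z) with ((F j z - F j x) + F j x) at 1 by ring. apply Rabs_triang. }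
    nra.
Qed.

(** A move of length at most [W n / (exp 1 * W (S n))] costs a factor at most [exp 1], so the level
    drops only from [S n] to [n]. For [j > n] the a priori bound suffices, the exponential being at
    least 1. *)
Lemma bang_step (W : nat -> R) (F : nat -> R -> R) (A x y : R) (n : nat) :
  (forall p, 0 < W p) -> LogConvex W -> 0 <= A -> x <= y ->
  exp 1 * (y - x) <= W n / W (S n) ->
  (forall j z, x <= z <= y -> derivable_pt_lim (F j) z (F (S j) z)) ->
  (forall j z, x <= z <= y -> Rabs (F j z) <= A * W j) ->
  (forall j, Rabs (F j x) <= A * exp (INR j - INR (S n)) * W j) ->
  forall j, Rabs (F j y) <= A * exp (INR j - INR n) * W j.
Proof.
  intros Hpos Hlc HA Hxy Hlen HD HB H0 j.
  assert (HW := Hpos j).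
  destruct (le_lt_dec j n) as [Hj|Hj].
  - apply Rle_trans with
      (1 := bang_exp_bound W F A x y n Hpos Hlc HA Hxy HD HB H0 (S n - j) j y
              ltac:(lia) ltac:(lra)).
    replace (INR j - INR n) with ((INR j - INR (S n)) + 1) by (rewrite S_INR; ring).
    rewrite (exp_plus _ 1).
    assert (He : exp (exp 1 * (W (S n) / W n) * (y - x)) <= exp 1).
    { assert (Hle : exp 1 * (W (S n) / W n) * (y - x) <= 1).
      { assert (Hn := Hpos n). assert (Hn' := Hpos (S n)).
        replace 1 with (W n / W (S n) * (W (S n) / W n)) at 2 by (field; lra).
        assert (0 < W (S n) / W n) by now apply Rdiv_lt_0_compat.
        nra. }
      destruct Hle as [Hle|Hle]; [left; now apply exp_increasing|rewrite Hle; lra]. }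
    assert (0 <= A * exp (INR j - INR (S n)) * W j).
    { apply Rmult_le_pos; [apply Rmult_le_pos; [lra|left; apply exp_pos]|lra]. }
    nra.
  - apply Rle_trans with (1 := HB j y ltac:(lra)).
    assert (Hjn : INR n < INR j) by now apply lt_INR.
    assert (1 <= exp (INR j - INR n)).
    { rewrite <- exp_0 at 1. left. apply exp_increasing. lra. }
    assert (0 <= A * W j) by nra. nra.
Qed.

(** Iterates [bang_step]: each drop of one level pays for one piece of the way from [x] to [delta],
    and the block of the quasianalytic series between [k] and [k + d] is the total budget. *)
Lemma bang_walk (W : nat -> R) (F : nat -> R -> R) (A delta : R) (k : nat) :
  (forall p, 0 < W p) -> LogConvex W -> 0 <= A ->
  (forall j z, 0 <= z <= delta -> derivable_pt_lim (F j) z (F (S j) z)) ->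
  (forall j z, 0 <= z <= delta -> Rabs (F j z) <= A * W j) ->
  forall d x, 0 <= x <= delta ->
  exp 1 * (delta - x) <= sum_f_R0 (fun p => W p / W (S p)) (k + d)
                         - sum_f_R0 (fun p => W p / W (S p)) k ->
  (forall j, Rabs (F j x) <= A * exp (INR j - INR (S (k + d))) * W j) ->
  forall j, Rabs (F j delta) <= A * exp (INR j - INR (S k)) * W j.
Proof.
  intros Hpos Hlc HA HD HB. assert (He := exp_pos 1).
  induction d as [|d IH]; intros x Hx Hs H0.
  (* An empty budget forces [x = delta]. *)
  - rewrite Nat.add_0_r in *. replace delta with x by nra. exact H0.
  - rewrite Nat.add_succ_r in *. simpl sum_f_R0 in Hs.
    set (t := W (S (k + d)) / W (S (S (k + d)))) in *.
    assert (Ht : 0 < t) by now apply Rdiv_lt_0_compat.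
    assert (Hmono : 0 <= sum_f_R0 (fun p => W p / W (S p)) (k + d)
                         - sum_f_R0 (fun p => W p / W (S p)) k).
    { clear - Hpos. induction d as [|d IH]; [rewrite Nat.add_0_r; lra|].
      rewrite Nat.add_succ_r. simpl.
      assert (0 < W (S (k + d)) / W (S (S (k + d)))) by now apply Rdiv_lt_0_compat.
      lra. }
    (* Move by the full length allowed at this level, but stop at [delta]; in the latter case
       [Hmono] says that the remaining budget is nonnegative. *)
    set (y := Rmin delta (x + t / exp 1)).
    assert (Htq : 0 < t / exp 1) by now apply Rdiv_lt_0_compat.
    assert (Heq : exp 1 * (t / exp 1) = t) by (field; lra).
    assert (Hy : x <= y <= delta).
    { unfold y, Rmin. destruct Rle_dec; lra. }
    apply (IH y); [lra| |].
    + unfold y, Rmin. destruct Rle_dec; nra.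
    + apply (bang_step W F A x y); auto.
      * lra.
      * fold t. unfold y, Rmin. destruct Rle_dec; nra.
      * intros; apply HD; lra.
      * intros; apply HB; lra.
Qed.

(** A finite form of the Denjoy-Carleman theorem. The point is uniformity: [J] and [eta] are fixed
    before [F], so the conclusion survives small perturbations of the jet at 0. *)
Lemma quasianalytic_stability (W : nat -> R) (A delta : R) :
  (forall p, 0 < W p) -> LogConvex W -> Quasianalytic W -> 0 < A -> 0 < delta ->
  exists J eta, 0 < eta /\ forall F : nat -> R -> R,
  (forall j z, 0 <= z <= delta -> derivable_pt_lim (F j) z (F (S j) z)) ->
  (forall j z, 0 <= z <= delta -> Rabs (F j z) <= A * W j) ->
  (forall j, (j <= J)%nat -> Rabs (F j 0) <= eta) ->
  Rabs (F 0%nat delta) <= 1.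
Proof.
  intros Hpos Hlc Hqa HA Hd.
  assert (HW0 := Hpos 0%nat).
  (* The walk will end at level [S k]; this choice gives [A * W 0 <= exp (k + 1)], hence the final
     bound 1. Divergence then supplies [n] with a budget exceeding [exp 1 * delta]. *)
  destruct (INR_unbounded (A * W 0%nat)) as [k Hk].
  set (S' := sum_f_R0 (fun p => W p / W (S p))).
  destruct (Hqa (exp 1 * delta + S' k)) as [n Hn]. fold S' in Hn.
  assert (He := exp_pos 1).
  assert (Hkn : (k < n)%nat).
  { destruct (le_lt_dec n k) as [Hle|]; [exfalso|assumption].
    assert (S' n <= S' k); [|nra].
    clear - Hle Hpos. induction Hle; [lra|].
    unfold S' in *; simpl.
    assert (0 < W (S m) / W (S (S m))) by now apply Rdiv_lt_0_compat. lra. }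
  destruct (finite_pos_lower_bound (fun j => A * exp (INR j - INR (S n)) * W j) n)
    as [eta [Heta Hlow]].
  { intros j. apply Rmult_lt_0_compat; auto.
    apply Rmult_lt_0_compat; auto. apply exp_pos. }
  exists n, eta. split; [assumption|]. intros F HD HB H0.
  assert (Hfin : Rabs (F 0%nat delta) <= A * exp (INR 0 - INR (S k)) * W 0%nat).
  { apply (bang_walk W F A delta k Hpos Hlc ltac:(lra) HD HB (n - k) 0); [lra| |].
    - replace (k + (n - k))%nat with n by lia. fold S'. lra.
    - replace (k + (n - k))%nat with n by lia. intros j.
      (* Only the orders [j <= n] need smallness at 0; beyond [n] the starting bound is weaker than
         the a priori one. *)
      destruct (le_lt_dec j n) as [Hj|Hj].
      + apply Rle_trans with (1 := H0 j Hj). now apply Hlow.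
      + apply Rle_trans with (1 := HB j 0 ltac:(lra)).
        assert (Hjn : INR (S n) <= INR j) by (apply le_INR; lia).
        assert (1 <= exp (INR j - INR (S n))).
        { rewrite <- exp_0 at 1.
          destruct Hjn as [Hjn|Hjn]; [left; apply exp_increasing; lra|].
          rewrite Hjn, Rminus_diag. lra. }
        assert (0 < A * W j) by now apply Rmult_lt_0_compat. nra. }
  apply Rle_trans with (1 := Hfin).
  replace (INR 0 - INR (S k)) with (- INR (S k)) by (simpl INR; ring).
  rewrite exp_Ropp. rewrite S_INR.
  assert (H1 := exp_ineq1_le (INR k + 1)).
  apply Rmult_le_reg_r with (exp (INR k + 1)); [apply exp_pos|].
  replace (A * / exp (INR k + 1) * W 0%nat * exp (INR k + 1)) with (A * W 0%nat)
    by (field; apply Rgt_not_eq, exp_pos).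
  lra.
Qed.

(** * Derivatives of monomials *)

(** The truncated [pred] is harmless: at [p = 0] the factor [INR p] vanishes. *)
Fixpoint monomial_deriv (j p : nat) (x : R) : R :=
  match j with
  | 0 => x ^ p
  | S j' => INR p * monomial_deriv j' (pred p) x
  end.

Lemma monomial_deriv_correct (j p : nat) (x : R) :
  derivable_pt_lim (monomial_deriv j p) x (monomial_deriv (S j) p x).
Proof.
  revert p. induction j as [|j IH]; intros p.
  - apply derivable_pt_lim_pow.
  - apply (derivable_pt_lim_scal (monomial_deriv j (pred p))). apply IH.
Qed.

Lemma monomial_deriv_at_0 (j p : nat) :
  monomial_deriv j p 0 = if Nat.eqb j p then INR (fact j) else 0.
Proof.
  revert p. induction j as [|j IH]; intros [|p].
  - reflexivity.
  - simpl. ring.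
  - simpl. ring.
  - simpl monomial_deriv. rewrite IH. simpl Nat.eqb.
    destruct (Nat.eqb_spec j p) as [->|]; [|ring].
    change (fact (S p)) with (S p * fact p)%nat. rewrite mult_INR. reflexivity.
Qed.

Lemma monomial_deriv_vanish (j p : nat) (x : R) :
  (p < j)%nat -> monomial_deriv j p x = 0.
Proof.
  revert p. induction j as [|j IH]; intros p Hp; [lia|].
  simpl. destruct p as [|p]; [simpl; ring|]. rewrite IH; [ring|simpl; lia].
Qed.

Lemma monomial_deriv_bound (j p : nat) (x : R) :
  0 <= x <= 1 -> Rabs (monomial_deriv j p x) <= INR (fact p).
Proof.
  intros Hx. revert p. induction j as [|j IH]; intros p.
  - simpl. rewrite <- RPow_abs, Rabs_right by lra.
    apply Rle_trans with 1.
    + rewrite <- (pow1 p). apply pow_incr. lra.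
    + apply (le_INR 1). apply lt_O_fact.
  - simpl. rewrite Rabs_mult, (Rabs_right (INR p)) by (apply Rle_ge, pos_INR).
    destruct p as [|p].
    + simpl. lra.
    + change (fact (S p)) with (S p * fact p)%nat. rewrite mult_INR.
      apply Rmult_le_compat_l; [apply pos_INR|]. apply IH.
Qed.

(** Only the orders up to [p] give nonzero derivatives, and [W] has a positive minimum over them. *)
Lemma monomial_deriv_weight_bound (W : nat -> R) (p : nat) :
  (forall j, 0 < W j) ->
  exists A, 0 < A /\ forall j x, 0 <= x <= 1 -> Rabs (monomial_deriv j p x) <= A * W j.
Proof.
  intros HW. destruct (finite_pos_lower_bound W p HW) as [m [Hm Hlow]].
  assert (Hf : 0 < INR (fact p)) by apply INR_fact_lt_0.
  exists (INR (fact p) / m). split; [now apply Rdiv_lt_0_compat|].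
  assert (HA : 0 < INR (fact p) / m) by now apply Rdiv_lt_0_compat.
  intros j x Hx. destruct (le_lt_dec j p) as [Hj|Hj].
  - apply Rle_trans with (1 := monomial_deriv_bound j p x Hx).
    assert (H := Hlow j Hj).
    replace (INR (fact p)) with (INR (fact p) / m * m) at 1 by (field; lra). nra.
  - rewrite monomial_deriv_vanish, Rabs_R0 by assumption. assert (H := HW j). nra.
Qed.

(** * Restriction to the first coordinate axis *)

Definition axis (j i : nat) : nat := match i with 0%nat => j | S _ => 0%nat end.

Lemma axis_MultiIdx (r j : nat) : (1 <= r)%nat -> MultiIdx r (axis j).
Proof. intros Hr [|i] Hi; [lia|reflexivity]. Qed.

Lemma absM_axis (r j : nat) : (1 <= r)%nat -> absM r (axis j) = j.
Proof.
  intros Hr. induction Hr as [|r Hr IH]; [reflexivity|].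
  destruct r as [|r]; [lia|]. change (absM (S r) (axis j) + 0 = j)%nat. lia.
Qed.

Lemma word_axis (r j : nat) : (1 <= r)%nat -> word r (axis j) = repeat 0%nat j.
Proof.
  intros Hr. induction Hr as [|r Hr IH]; [reflexivity|].
  destruct r as [|r]; [lia|].
  change (word (S r) (axis j) ++ nil = repeat 0%nat j). now rewrite app_nil_r.
Qed.

Definition axis_pt (t : R) : nat -> R := upd (fun _ => 0) 0 t.

Lemma axis_pt_IsPt (r : nat) (t : R) : (1 <= r)%nat -> IsPt r (axis_pt t).
Proof. intros Hr [|i] Hi; [lia|reflexivity]. Qed.

Lemma upd_axis_pt (s t : R) : upd (axis_pt s) 0 t = axis_pt t.
Proof. apply functional_extensionality. intros [|i]; reflexivity. Qed.

Lemma axis_pt_0 : axis_pt 0 = (fun _ => 0).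
Proof. apply functional_extensionality. intros [|i]; reflexivity. Qed.

Lemma axis_pt_sub_lt (s t d : R) (i : nat) :
  0 < d -> Rabs (s - t) < d -> Rabs (axis_pt s i - axis_pt t i) < d.
Proof.
  intros Hd Hst. destruct i as [|i]; [exact Hst|].
  unfold axis_pt, upd. simpl. now rewrite Rminus_diag, Rabs_R0.
Qed.

(** Heine-Borel on the axis, needed because the Roumieu bounds are given on compact sets. The proof
    takes the supremum [m] of the end points whose initial segment has a finite subcover. *)
Lemma compact_axis_segment (r : nat) (d : R) :
  (1 <= r)%nat -> 0 <= d ->
  CompactR r (fun x => exists t, 0 <= t <= d /\ x = axis_pt t).
Proof.
  intros Hr Hd. split.
  { intros x [t [_ ->]]. now apply axis_pt_IsPt. }
  intros I O HO Hcov.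
  set (E := fun t => 0 <= t <= d /\ exists l, forall s, 0 <= s <= t ->
              exists i : I, In i l /\ O i (axis_pt s)).
  assert (HE0 : E 0).
  { split; [lra|].
    destruct (Hcov (axis_pt 0)) as [i Hi]; [exists 0; split; [lra|reflexivity]|].
    exists (i :: nil). intros s Hs. exists i. split; [now left|].
    now replace s with 0 by lra. }
  destruct (completeness E) as [m [Hub Hlub]].
  { exists d. intros t [Ht _]. lra. }
  { now exists 0. }
  assert (Hm0 := Hub 0 HE0).
  assert (Hmd : m <= d) by (apply Hlub; intros t [Ht _]; lra).
  destruct (Hcov (axis_pt m)) as [i0 Hi0]; [exists m; split; [lra|reflexivity]|].
  destruct (HO i0 _ Hi0) as [_ [rho [Hrho Hball]]].
  assert (Hex : exists t, E t /\ m - rho < t).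
  { apply NNPP. intros Hno. apply (Rlt_irrefl m).
    apply Rle_lt_trans with (m - rho); [|lra].
    apply Hlub. intros t Ht. apply Rnot_lt_le. intros Hlt. apply Hno. now exists t. }
  destruct Hex as [t [[Ht [l Hl]] Htm]].
  assert (Htm' : t <= m) by (apply Hub; split; [lra|now exists l]).
  (* One more open set carries the subcover to [q]; since [q <= m] by the choice of [m], the cut-off
     at [d] must be active. *)
  set (q := Rmin d (m + rho / 2)).
  assert (Hq : E q).
  { split; [unfold q, Rmin; destruct Rle_dec; lra|].
    exists (i0 :: l). intros s Hs.
    destruct (Rle_dec s t) as [Hst|Hst].
    - destruct (Hl s ltac:(lra)) as [i [Hi Hi']]. exists i. split; [now right|assumption].
    - exists i0. split; [now left|]. apply Hball; [now apply axis_pt_IsPt|].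
      intros i _. apply axis_pt_sub_lt; [assumption|].
      assert (s <= m + rho / 2) by (apply Rle_trans with q; [lra|apply Rmin_r]).
      unfold Rabs; destruct Rcase_abs; lra. }
  assert (Hqm := Hub q Hq).
  assert (Hqd : q = d) by (unfold q, Rmin in *; destruct Rle_dec; lra).
  rewrite Hqd in Hq. destruct Hq as [_ [l' Hl']].
  exists l'. intros x [s [Hs ->]]. now apply Hl'.
Qed.

(** [F j] stands for the [j]-th derivative of [F 0]; the factorial undoes the normalisation in the
    Borel map. *)
Definition AxisJet (W : nat -> R) (A delta : R) (c : MSeq) : Prop :=
  exists F : nat -> R -> R,
    (forall j z, 0 <= z <= delta -> derivable_pt_lim (F j) z (F (S j) z)) /\
    (forall j z, 0 <= z <= delta -> Rabs (F j z) <= A * W j) /\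
    (forall j, F j 0 = INR (fact j) * c (axis j)).

(** A single integer controls the constant, the geometric factor and the length of the interval, so
    that countably many sets cover the image. The shift to [S n] keeps it positive. *)
Definition AxisJetN (M : nat -> R) (n : nat) : MSeq -> Prop :=
  AxisJet (fun j => INR (S n) ^ j * M j) (INR (S n)) (/ INR (S n)).

Lemma BorelImageRoumieu_AxisJetN (r : nat) (M : nat -> R) (b : MSeq) :
  (1 <= r)%nat -> (forall p, 0 < M p) ->
  BorelImageRoumieu r M b -> exists n, AxisJetN M n b.
Proof.
  intros Hr HM [k [f [D [Hk [[[_ [HD _]] Hbd] Hb]]]]].
  assert (Hk' : 1 <= INR k) by now apply (le_INR 1).
  (* Half the side bound, so that the closed segment lies in the open cube. *)
  set (d := / (2 * INR k)).
  assert (Hd : 0 < d) by (apply Rinv_0_lt_compat; lra).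
  assert (Hdk : d < / INR k) by (apply Rinv_lt_contravar; nra).
  assert (Hcube : forall t, 0 <= t <= d -> Cube r k (axis_pt t)).
  { intros t Ht. split; [now apply axis_pt_IsPt|].
    intros i _. replace (axis_pt t i) with (axis_pt t i - axis_pt 0 i)
      by (rewrite axis_pt_0; ring).
    apply axis_pt_sub_lt; [lra|]. rewrite Rabs_right; lra. }
  destruct (Hbd _ (compact_axis_segment r d Hr ltac:(lra))) as [h [Hh [C HC]]].
  { intros x [t [Ht ->]]. now apply Hcube. }
  (* One [n] dominates [2 * INR k], [h] and [C]: a larger [n] only shortens the interval and loosens
     the bounds. *)
  destruct (INR_unbounded (Rmax (2 * INR k) (Rmax h C))) as [n Hn].
  assert (Hn1 : 2 * INR k < INR n) by (eapply Rle_lt_trans; [apply Rmax_l|exact Hn]).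
  assert (Hn2 : Rmax h C < INR n) by (eapply Rle_lt_trans; [apply Rmax_r|exact Hn]).
  assert (Hn3 : h < INR n) by (eapply Rle_lt_trans; [apply Rmax_l|exact Hn2]).
  assert (Hn4 : C < INR n) by (eapply Rle_lt_trans; [apply Rmax_r|exact Hn2]).
  exists n. assert (HSn := S_INR n).
  assert (Hdn : / INR (S n) <= d) by (apply Rinv_le_contravar; lra).
  assert (Hw : forall j x, Pderiv D r (axis j) x = D (repeat 0%nat j) x).
  { intros j x. unfold Pderiv. now rewrite word_axis. }
  exists (fun j t => D (repeat 0%nat j) (axis_pt t)). repeat split.
  - intros j z Hz.
    assert (H := HD (repeat 0%nat j) 0%nat (axis_pt z)).
    replace (fun t => D (repeat 0%nat j) (upd (axis_pt z) 0 t))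
      with (fun t => D (repeat 0%nat j) (axis_pt t)) in H
      by (apply functional_extensionality; intros t; now rewrite upd_axis_pt).
    apply H; [|lia|apply Hcube; lra].
    apply Forall_forall. intros i Hi. apply repeat_spec in Hi. lia.
  - intros j z Hz.
    assert (H := HC (axis j) (axis_pt z) (axis_MultiIdx r j Hr)).
    rewrite Hw, absM_axis in H by assumption.
    eapply Rle_trans; [apply H; exists z; split; [lra|reflexivity]|].
    assert (0 < h ^ j) by now apply pow_lt.
    assert (h ^ j <= INR (S n) ^ j) by (apply pow_incr; lra).
    assert (HMj := HM j).
    assert (0 < h ^ j * M j) by now apply Rmult_lt_0_compat.
    assert (h ^ j * M j <= INR (S n) ^ j * M j) by (apply Rmult_le_compat_r; lra).
    apply Rle_trans with (INR (S n) * (h ^ j * M j)); nra.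
  - intros j. rewrite (Hb (axis j) (axis_MultiIdx r j Hr)), Hw, absM_axis, axis_pt_0
      by assumption.
    field. apply INR_fact_neq_0.
Qed.

(** * Balls and category in the Frechet space *)

Lemma weighted_pow_pos (N : nat -> R) (h : R) (p : nat) :
  (forall p, 0 < N p) -> 0 < h -> 0 < h ^ p * small N p.
Proof.
  intros HN Hh. apply Rmult_lt_0_compat; [now apply pow_lt|].
  apply Rdiv_lt_0_compat; [apply HN|apply INR_fact_lt_0].
Qed.

Lemma weighted_pow_le (N : nat -> R) (h h' : R) (p : nat) :
  (forall p, 0 < N p) -> 0 < h' <= h -> h' ^ p * small N p <= h ^ p * small N p.
Proof.
  intros HN Hh. apply Rmult_le_compat_r; [|apply pow_incr; lra].
  left. apply Rdiv_lt_0_compat; [apply HN|apply INR_fact_lt_0].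
Qed.

Lemma Ball_center (r : nat) (N : nat -> R) (b : MSeq) (h eps : R) :
  (forall p, 0 < N p) -> 0 < h -> 0 < eps -> Ball r N b h eps b.
Proof.
  intros HN Hh Heps a _. rewrite Rminus_diag, Rabs_R0.
  assert (H := weighted_pow_pos N h (absM r a) HN Hh). nra.
Qed.

Lemma Ball_trans (r : nat) (N : nat -> R) (b c d : MSeq) (h e1 e2 : R) :
  Ball r N b h e1 c -> Ball r N c h e2 d -> Ball r N b h (e1 + e2) d.
Proof.
  intros H1 H2 a Ha. assert (G1 := H1 a Ha). assert (G2 := H2 a Ha).
  replace (d a - b a) with ((d a - c a) + (c a - b a)) by ring.
  eapply Rle_trans; [apply Rabs_triang|]. lra.
Qed.

Lemma Ball_weaken (r : nat) (N : nat -> R) (b c : MSeq) (h h' e e' : R) :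
  (forall p, 0 < N p) -> 0 < h' <= h -> 0 < e' <= e ->
  Ball r N b h' e' c -> Ball r N b h e c.
Proof.
  intros HN Hh He H a Ha. apply Rle_trans with (1 := H a Ha).
  assert (G1 := weighted_pow_le N h h' (absM r a) HN Hh).
  assert (G2 := weighted_pow_pos N h' (absM r a) HN ltac:(lra)). nra.
Qed.

(** The interior of the complement of [A] in the Fréchet space. A ball of one seminorm suffices,
    since the seminorms grow as [h] decreases. *)
Definition AwayFrom (r : nat) (N : nat -> R) (A : MSeq -> Prop) (b : MSeq) : Prop :=
  exists h eps, 0 < h /\ 0 < eps /\
    forall c, InLambda r N c -> Ball r N b h eps c -> ~ A c.

Lemma AwayFrom_open (r : nat) (N : nat -> R) (A : MSeq -> Prop) :
  LOpen r N (AwayFrom r N A).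
Proof.
  intros b _ [h [eps [Hh [He H]]]]. exists h, (eps / 2).
  repeat split; [assumption|lra|].
  intros c _ Hbc. exists h, (eps / 2). repeat split; [assumption|lra|].
  intros d Hd Hcd. apply H; [assumption|].
  replace eps with (eps / 2 + eps / 2) by field. now apply Ball_trans with c.
Qed.

Lemma not_AwayFrom (r : nat) (N : nat -> R) (A : MSeq -> Prop) (b : MSeq) :
  ~ AwayFrom r N A b ->
  forall h eps, 0 < h -> 0 < eps -> exists c, Ball r N b h eps c /\ A c.
Proof.
  intros Hn h eps Hh He. apply NNPP. intros Hno. apply Hn.
  exists h, eps. repeat split; try assumption. intros c _ Hc HA. apply Hno. now exists c.
Qed.

(** * Density by perturbing one order *)

(** All coefficients of order [p] are shifted, so the seminorm estimates depend on [absM r a] alone;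
    on the axis this adds exactly [s x^p]. *)
Definition add_level (r p : nat) (s : R) (b : MSeq) : MSeq :=
  fun a => b a + if Nat.eqb (absM r a) p then s else 0.

Lemma add_level_InLambda (r p : nat) (N : nat -> R) (s : R) (b : MSeq) :
  (forall p, 0 < N p) -> InLambda r N b -> InLambda r N (add_level r p s b).
Proof.
  intros HN Hb h Hh. destruct (Hb h Hh) as [C HC].
  assert (Hp := weighted_pow_pos N h p HN Hh).
  exists (C + Rabs s / (h ^ p * small N p)). intros a Ha.
  assert (G := HC a Ha). unfold add_level.
  eapply Rle_trans; [apply Rabs_triang|].
  rewrite Rmult_plus_distr_r. apply Rplus_le_compat; [assumption|].
  destruct (Nat.eqb_spec (absM r a) p) as [->|_].
  - right. unfold Rdiv. rewrite Rmult_assoc, Rinv_l, Rmult_1_r; lra.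
  - rewrite Rabs_R0. apply Rmult_le_pos.
    + apply Rmult_le_pos; [apply Rabs_pos|]. left. now apply Rinv_0_lt_compat.
    + left. now apply weighted_pow_pos.
Qed.

Lemma add_level_Ball (r p : nat) (N : nat -> R) (h eps : R) (b : MSeq) :
  (forall p, 0 < N p) -> 0 < h -> 0 < eps ->
  Ball r N b h eps (add_level r p (eps * (h ^ p * small N p)) b).
Proof.
  intros HN Hh He a _. unfold add_level.
  assert (G := weighted_pow_pos N h (absM r a) HN Hh).
  destruct (Nat.eqb_spec (absM r a) p) as [<-|_].
  - right. rewrite Rplus_minus_l. apply Rabs_right. nra.
  - rewrite Rplus_0_r, Rminus_diag, Rabs_R0. nra.
Qed.

(* Two axis jets close to [b] and to [b + s x^p] respectively would have
   representatives whose difference is, by quasianalytic stability, within [1]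
   of [s x^p] at [delta], although it is bounded by [2 A W_0] there. *)
Lemma axis_jet_gap (r p : nat) (W N : nat -> R) (A delta s : R) (b : MSeq) :
  (1 <= r)%nat -> (forall j, 0 < W j) -> LogConvex W -> Quasianalytic W ->
  (forall j, 0 < N j) -> 0 < A -> 0 < delta <= 1 ->
  0 <= s -> 1 + 2 * (A * W 0%nat) < s * delta ^ p ->
  AwayFrom r N (AxisJet W A delta) b \/
  AwayFrom r N (AxisJet W A delta) (add_level r p s b).
Proof.
  intros Hr HW Hlc Hqa HN HA Hd Hs Hbig.
  apply NNPP. intros Hno. apply not_or_and in Hno. destruct Hno as [Hn1 Hn2].
  destruct (monomial_deriv_weight_bound W p HW) as [P [HP HPb]].
  (* The constant bounds the function [u] below: [A] from each of the two representatives and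
     [s * P] from the monomial. *)
  destruct (quasianalytic_stability W (2 * A + s * P) delta HW Hlc Hqa)
    as [J [eta [Heta Hstab]]]; [nra|lra|].
  (* Two errors of size [e * small N j], multiplied by [j!], amount to [2 * e * N j], which must not
     exceed [eta] for [j <= J]. *)
  destruct (finite_pos_lower_bound (fun j => eta / (2 * N j)) J) as [e [He Hlow]].
  { intros j. apply Rdiv_lt_0_compat; [assumption|]. assert (H := HN j). lra. }
  destruct (not_AwayFrom _ _ _ _ Hn1 1 e ltac:(lra) He) as [b' [Hb' [F [F1 [F2 F3]]]]].
  destruct (not_AwayFrom _ _ _ _ Hn2 1 e ltac:(lra) He) as [c' [Hc' [G [G1 [G2 G3]]]]].
  set (u := fun j x => (G j x - F j x) - s * monomial_deriv j p x).
  assert (Hu : Rabs (u 0%nat delta) <= 1).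
  { apply Hstab.
    - intros j z Hz. unfold u.
      apply (derivable_pt_lim_minus (fun x => G j x - F j x)
               (fun x => s * monomial_deriv j p x)).
      + apply (derivable_pt_lim_minus (G j) (F j)); auto.
      + apply (derivable_pt_lim_scal (monomial_deriv j p)).
        apply monomial_deriv_correct.
    - intros j z Hz. unfold u.
      assert (H1 := F2 j z Hz). assert (H2 := G2 j z Hz).
      assert (H3 := HPb j z ltac:(lra)).
      unfold Rminus at 1. eapply Rle_trans; [apply Rabs_triang|].
      unfold Rminus at 1. eapply Rle_trans;
        [apply Rplus_le_compat_r, Rabs_triang|].
      rewrite !Rabs_Ropp, Rabs_mult, (Rabs_right s) by lra. nra.
    - intros j Hj. unfold u. rewrite F3, G3, monomial_deriv_at_0.
      assert (Hax := axis_MultiIdx r j Hr).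
      assert (H1 := Hb' _ Hax). assert (H2 := Hc' _ Hax).
      unfold add_level in H2. rewrite absM_axis in H1, H2 by assumption.
      rewrite pow1 in H1, H2. assert (H3 := Hlow j Hj). simpl in H3.
      assert (Hf := INR_fact_lt_0 j). assert (HNj := HN j).
      set (v := if Nat.eqb j p then s else 0) in *.
      replace (s * (if Nat.eqb j p then INR (fact j) else 0)) with (INR (fact j) * v)
        by (unfold v; destruct (Nat.eqb j p); ring).
      replace (INR (fact j) * c' (axis j) - INR (fact j) * b' (axis j) - INR (fact j) * v)
        with (INR (fact j) * ((c' (axis j) - (b (axis j) + v))
                              + - (b' (axis j) - b (axis j)))) by ring.
      rewrite Rabs_mult, (Rabs_right (INR (fact j))) by lra.
      apply Rle_trans with (INR (fact j) * (2 * (e * small N j))).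
      + apply Rmult_le_compat_l; [lra|].
        eapply Rle_trans; [apply Rabs_triang|]. rewrite Rabs_Ropp. lra.
      + unfold small.
        replace (INR (fact j) * (2 * (e * (N j / INR (fact j))))) with (e * (2 * N j))
          by (field; lra).
        replace eta with (eta / (2 * N j) * (2 * N j)) by (field; lra).
        apply Rmult_le_compat_r; lra. }
  (* Both representatives are at most [A * W 0] at [delta], so [s * delta ^ p <= 1 + 2 * (A * W 0)],
     contradicting [Hbig]. *)
  assert (H1 := F2 0%nat delta ltac:(lra)). assert (H2 := G2 0%nat delta ltac:(lra)).
  unfold u in Hu. simpl in Hu. revert Hu H1 H2.
  unfold Rabs; repeat destruct Rcase_abs; lra.
Qed.

Lemma scaled_LogConvex (M : nat -> R) (h : R) :
  0 < h -> LogConvex M -> LogConvex (fun j => h ^ j * M j).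
Proof.
  intros Hh HM p. assert (H := HM p). simpl.
  assert (0 < h ^ p) by now apply pow_lt.
  assert (0 < h * h ^ p) by nra.
  replace (h * h ^ p * M (S p) * (h * h ^ p * M (S p)))
    with (h * h ^ p * (h * h ^ p) * (M (S p) * M (S p))) by ring.
  replace (h ^ p * M p * (h * (h * h ^ p) * M (S (S p))))
    with (h * h ^ p * (h * h ^ p) * (M p * M (S (S p)))) by ring.
  apply Rmult_le_compat_l; nra.
Qed.

(** Rescaling divides every term of the series by [h], which preserves divergence. *)
Lemma scaled_Quasianalytic (M : nat -> R) (h : R) :
  0 < h -> (forall p, 0 < M p) -> Quasianalytic M ->
  Quasianalytic (fun j => h ^ j * M j).
Proof.
  intros Hh HM Hq B. destruct (Hq (h * B)) as [n Hn]. exists n.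
  rewrite (sum_eq _ (fun p => M p / M (S p) * / h)).
  - rewrite <- scal_sum. apply Rmult_lt_reg_l with h; [assumption|].
    rewrite <- Rmult_assoc, Rinv_r, Rmult_1_l; lra.
  - intros p _. simpl. field.
    repeat split; try lra; apply Rgt_not_eq; [apply HM|now apply pow_lt].
Qed.

Lemma root_unbounded_beats_geometric (N : nat -> R) :
  (forall p, 0 < N p) ->
  (forall B, exists K, forall k, (K <= k)%nat -> (1 <= k)%nat ->
      B < Rpower (small N k) (/ INR k)) ->
  forall q C, 0 < q -> exists p, C < q ^ p * small N p.
Proof.
  intros HN Hroot q C Hq.
  (* Once the roots exceed [2 / q], the product [q ^ p * small N p] is at least [2 ^ p]. *)
  assert (HB : 0 < 2 / q) by (apply Rdiv_lt_0_compat; lra).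
  destruct (Hroot (2 / q)) as [K HK].
  destruct (Pow_x_infinity 2 ltac:(rewrite Rabs_right; lra) (C + 1)) as [K' HK'].
  set (p := S (K + K')). exists p.
  assert (H1 := HK p ltac:(unfold p; lia) ltac:(unfold p; lia)).
  assert (H2 := HK' p ltac:(unfold p; lia)).
  rewrite Rabs_right in H2 by (apply Rle_ge, pow_le; lra).
  assert (Hn : 0 < small N p) by (apply Rdiv_lt_0_compat; [apply HN|apply INR_fact_lt_0]).
  assert (Hp : 0 < INR p) by (apply lt_0_INR; unfold p; lia).
  assert (H3 : (2 / q) ^ p <= small N p).
  { replace (small N p) with (Rpower (small N p) (/ INR p) ^ p).
    - apply pow_incr. lra.
    - rewrite <- Rpower_pow by apply exp_pos.
      rewrite Rpower_mult, Rinv_l, Rpower_1; lra. }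
  apply Rlt_le_trans with (q ^ p * (2 / q) ^ p).
  - rewrite <- Rpow_mult_distr. replace (q * (2 / q)) with 2 by (field; lra). lra.
  - apply Rmult_le_compat_l; [|assumption]. apply pow_le. lra.
Qed.

Lemma AwayFrom_AxisJetN_dense (r n : nat) (M N : nat -> R) :
  (1 <= r)%nat -> (forall p, 0 < M p) -> LogConvex M -> Quasianalytic M ->
  (forall p, 0 < N p) ->
  (forall B, exists K, forall k, (K <= k)%nat -> (1 <= k)%nat ->
      B < Rpower (small N k) (/ INR k)) ->
  LDense r N (AwayFrom r N (AxisJetN M n)).
Proof.
  intros Hr HM Hlc Hqa HN Hroot b Hb h eps Hh He.
  set (m := INR (S n)).
  assert (Hm : 1 <= m) by (unfold m; rewrite S_INR; assert (H := pos_INR n); lra).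
  set (W := fun j => m ^ j * M j).
  assert (HW : forall j, 0 < W j).
  { intros j. apply Rmult_lt_0_compat; [apply pow_lt; lra|apply HM]. }
  assert (Hd : 0 < / m <= 1).
  { split; [apply Rinv_0_lt_compat; lra|].
    rewrite <- Rinv_1. apply Rinv_le_contravar; lra. }
  (* The ratio is [h / m] because the largest shift staying in the ball,
     [s = eps * (h ^ p * small N p)], takes at [/ m] the value [eps * ((h / m) ^ p * small N p)].
     Then [b] or its shift is the required point. *)
  destruct (root_unbounded_beats_geometric N HN Hroot (h * / m)
              ((1 + 2 * (m * W 0%nat)) / eps)) as [p Hp]; [nra|].
  set (s := eps * (h ^ p * small N p)).
  assert (Hs : 0 < s) by (apply Rmult_lt_0_compat; [|apply weighted_pow_pos]; assumption).
  destruct (axis_jet_gap r p W N m (/ m) s b) as [H|H]; try assumption; try lra.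
  - apply scaled_LogConvex; [lra|assumption].
  - apply scaled_Quasianalytic; [lra|assumption|assumption].
  - apply (Rmult_lt_compat_l eps) in Hp; [|assumption].
    replace (eps * ((1 + 2 * (m * W 0%nat)) / eps)) with (1 + 2 * (m * W 0%nat)) in Hp
      by (field; lra).
    unfold s. rewrite Rpow_mult_distr in Hp. lra.
  - exists b. repeat split; try assumption. now apply Ball_center.
  - exists (add_level r p s b). repeat split; try assumption.
    + now apply add_level_InLambda.
    + now apply add_level_Ball.
Qed.

(** * Baire's theorem in the Fréchet space *)

(** Radius and weight both shrink below [/ INR (S n)]: small radii make the centres converge, small
    weights bring every seminorm under control. Halving [e] leaves room for nesting. *)
Lemma baire_step (r n : nat) (N : nat -> R) (O : MSeq -> Prop) :
  (forall p, 0 < N p) -> LOpen r N O -> LDense r N O ->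
  forall b h e, InLambda r N b -> 0 < h -> 0 < e ->
  exists b' h' e', InLambda r N b' /\ 0 < h' <= h /\ h' <= / INR (S n) /\
    0 < e' <= e / 2 /\ e' <= / INR (S n) /\ Ball r N b h (e / 2) b' /\
    forall c, InLambda r N c -> Ball r N b' h' e' c -> O c.
Proof.
  intros HN Hop Hde b h e Hb Hh He.
  destruct (Hde b Hb h (e / 2) Hh ltac:(lra)) as [b' [Hb' [HOb' Hbb']]].
  destruct (Hop b' Hb' HOb') as [h1 [e1 [Hh1 [He1 H1]]]].
  assert (Hn : 0 < / INR (S n)) by (apply Rinv_0_lt_compat, lt_0_INR; lia).
  exists b', (Rmin h1 (Rmin h (/ INR (S n)))), (Rmin e1 (Rmin (e / 2) (/ INR (S n)))).
  assert (Hr1 := Rmin_l h1 (Rmin h (/ INR (S n)))).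
  assert (Hr2 := Rmin_r h1 (Rmin h (/ INR (S n)))).
  assert (Hr3 := Rmin_l h (/ INR (S n))). assert (Hr4 := Rmin_r h (/ INR (S n))).
  assert (Hs1 := Rmin_l e1 (Rmin (e / 2) (/ INR (S n)))).
  assert (Hs2 := Rmin_r e1 (Rmin (e / 2) (/ INR (S n)))).
  assert (Hs3 := Rmin_l (e / 2) (/ INR (S n))).
  assert (Hs4 := Rmin_r (e / 2) (/ INR (S n))).
  assert (Hhp : 0 < Rmin h1 (Rmin h (/ INR (S n)))) by (repeat apply Rmin_glb_lt; lra).
  assert (Hep : 0 < Rmin e1 (Rmin (e / 2) (/ INR (S n))))
    by (repeat apply Rmin_glb_lt; lra).
  repeat split; try assumption; try lra.
  intros c Hc Hbc. apply H1; [assumption|].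
  eapply Ball_weaken; [assumption|..|exact Hbc]; split; assumption.
Qed.

(** Bundling a ball with its side conditions makes [baire_step] a total relation, as dependent
    choice requires. *)
Record BallDatum (r : nat) (N : nat -> R) := {
  ball_center : MSeq;
  ball_weight : R;
  ball_radius : R;
  ball_center_InLambda : InLambda r N ball_center;
  ball_weight_pos : 0 < ball_weight;
  ball_radius_pos : 0 < ball_radius }.

Lemma baire_sequence (r : nat) (N : nat -> R) (O : nat -> MSeq -> Prop) :
  (forall p, 0 < N p) -> (forall n, LOpen r N (O n) /\ LDense r N (O n)) ->
  forall b0 h0 e0, InLambda r N b0 -> 0 < h0 -> 0 < e0 ->
  exists (b : nat -> MSeq) (h e : nat -> R),
    b 0%nat = b0 /\ h 0%nat = h0 /\ e 0%nat = e0 /\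
    (forall n, InLambda r N (b n) /\ 0 < h n /\ 0 < e n) /\
    (forall n, h (S n) <= h n /\ h (S n) <= / INR (S n) /\
       e (S n) <= e n / 2 /\ e (S n) <= / INR (S n) /\
       Ball r N (b n) (h n) (e n / 2) (b (S n)) /\
       forall c, InLambda r N c -> Ball r N (b (S n)) (h (S n)) (e (S n)) c -> O n c).
Proof.
  intros HN HO b0 h0 e0 Hb0 Hh0 He0.
  set (step := fun n (x y : BallDatum r N) =>
    ball_weight r N y <= ball_weight r N x /\ ball_weight r N y <= / INR (S n) /\
    ball_radius r N y <= ball_radius r N x / 2 /\ ball_radius r N y <= / INR (S n) /\
    Ball r N (ball_center r N x) (ball_weight r N x) (ball_radius r N x / 2)
      (ball_center r N y) /\
    forall c, InLambda r N c ->
      Ball r N (ball_center r N y) (ball_weight r N y) (ball_radius r N y) c -> O n c).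
  assert (Hstep : forall n x, exists y, step n x y).
  { intros n [b h e Hb Hh He]. destruct (HO n) as [Hop Hde].
    destruct (baire_step r n N (O n) HN Hop Hde b h e Hb Hh He)
      as [b' [h' [e' [H1 [[H2 H3] [H4 [[H5 H6] [H7 [H8 H9]]]]]]]]].
    exists (Build_BallDatum r N b' h' e' H1 H2 H5). unfold step; simpl. auto 10. }
  set (next := fun n x => proj1_sig (constructive_indefinite_description _ (Hstep n x))).
  set (x := fix x n := match n with
                       | 0%nat => Build_BallDatum r N b0 h0 e0 Hb0 Hh0 He0
                       | S n' => next n' (x n')
                       end).
  exists (fun n => ball_center r N (x n)), (fun n => ball_weight r N (x n)),
    (fun n => ball_radius r N (x n)).
  repeat (split; [reflexivity|]). split.
  - intros n. destruct (x n); simpl. auto.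
  - intros n. change (x (S n)) with (next n (x n)).
    exact (proj2_sig (constructive_indefinite_description _ (Hstep n (x n)))).
Qed.

Lemma inv_INR_small (d : R) : 0 < d -> exists n, forall m, (n <= m)%nat -> / INR (S m) < d.
Proof.
  intros Hd. destruct (INR_unbounded (/ d)) as [n Hn]. exists n. intros m Hm.
  assert (H := le_INR _ _ Hm). assert (0 < / d) by now apply Rinv_0_lt_compat.
  rewrite S_INR, <- (Rinv_inv d). apply Rinv_lt_contravar; [nra|lra].
Qed.

Lemma Un_cv_dist_le (u : nat -> R) (l x d : R) (n : nat) :
  Un_cv u l -> (forall m, (n <= m)%nat -> Rabs (u m - x) <= d) -> Rabs (l - x) <= d.
Proof.
  intros Hu Hd. apply Rnot_lt_le. intros Hlt.
  destruct (Hu (Rabs (l - x) - d) ltac:(lra)) as [m Hm].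
  assert (H1 := Hm (max n m) ltac:(lia)). assert (H2 := Hd (max n m) ltac:(lia)).
  unfold Rdist in H1. rewrite Rabs_minus_sym in H1.
  assert (H3 := Rabs_triang (l - u (max n m)) (u (max n m) - x)).
  replace (l - u (max n m) + (u (max n m) - x)) with (l - x) in H3 by ring. lra.
Qed.

Lemma Lambda_Baire (r : nat) (N : nat -> R) (O : nat -> MSeq -> Prop) :
  (forall p, 0 < N p) -> (forall n, LOpen r N (O n) /\ LDense r N (O n)) ->
  LDense r N (fun b => forall n, O n b).
Proof.
  intros HN HO b0 Hb0 h0 e0 Hh0 He0.
  destruct (baire_sequence r N O HN HO b0 h0 e0 Hb0 Hh0 He0)
    as [b [h [e [Eb [Eh [Ee [Hpos Hst]]]]]]].
  assert (Hnest : forall n d c, Ball r N (b (n + d)%nat) (h (n + d)%nat) (e (n + d)%nat) c ->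
            Ball r N (b n) (h n) (e n) c).
  { intros n d c. induction d as [|d IH]; [now rewrite Nat.add_0_r|].
    rewrite Nat.add_succ_r. intros Hc. apply IH.
    destruct (Hst (n + d)%nat) as [S1 [_ [S3 [_ [S5 _]]]]].
    destruct (Hpos (n + d)%nat) as [_ [P2 P3]].
    destruct (Hpos (S (n + d))) as [_ [Q2 Q3]].
    replace (e (n + d)%nat) with (e (n + d)%nat / 2 + e (n + d)%nat / 2) by field.
    apply Ball_trans with (1 := S5).
    eapply Ball_weaken; [assumption|..|exact Hc]; lra. }
  assert (Hin : forall n m, (n <= m)%nat -> Ball r N (b n) (h n) (e n) (b m)).
  { intros n m Hnm. apply (Hnest n (m - n)%nat).
    replace (n + (m - n))%nat with m by lia.
    destruct (Hpos m) as [_ [P2 P3]]. now apply Ball_center. }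
  (* The implication sits under the existential so that a limit can be chosen for every [a], with an
     arbitrary value off the multi-indices. *)
  assert (Hlim : forall a, exists l, MultiIdx r a -> Un_cv (fun n => b n a) l).
  { intros a. destruct (classic (MultiIdx r a)) as [Ha|Ha]; [|exists 0; tauto].
    destruct (R_complete (fun n => b n a)) as [l Hl]; [|now exists l].
    set (w := 1 ^ absM r a * small N (absM r a)).
    assert (Hw : 0 < w) by (apply weighted_pow_pos; [assumption|lra]).
    intros eps Heps.
    destruct (inv_INR_small (eps / (2 * w))) as [n Hn]; [apply Rdiv_lt_0_compat; lra|].
    assert (Hnn := Hn n (Nat.le_refl n)).
    exists (S n). intros p q Hp Hq.
    destruct (Hst n) as [_ [S2 [_ [S4 _]]]]. destruct (Hpos (S n)) as [_ [P2 P3]].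
    assert (Hh1 : h (S n) <= 1).
    { apply Rle_trans with (1 := S2). rewrite <- Rinv_1.
      apply Rinv_le_contravar; [lra|]. apply (le_INR 1). lia. }
    assert (Hx : forall m, (m >= S n)%nat -> Rabs (b m a - b (S n) a) < eps / 2).
    { intros m Hm. apply Rle_lt_trans with (e (S n) * w).
      - apply (Ball_weaken r N (b (S n)) (b m) 1 (h (S n)) (e (S n)) (e (S n)));
          [assumption|lra|lra|now apply Hin|assumption].
      - apply Rlt_le_trans with (eps / (2 * w) * w).
        + apply Rmult_lt_compat_r; lra.
        + right. field. lra. }
    unfold Rdist.
    replace (b p a - b q a) with ((b p a - b (S n) a) + - (b q a - b (S n) a)) by ring.
    eapply Rle_lt_trans; [apply Rabs_triang|]. rewrite Rabs_Ropp.
    assert (G1 := Hx p Hp). assert (G2 := Hx q Hq). lra. }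
  set (c := fun a => proj1_sig (constructive_indefinite_description _ (Hlim a))).
  assert (Hc : forall a, MultiIdx r a -> Un_cv (fun n => b n a) (c a)).
  { intros a. exact (proj2_sig (constructive_indefinite_description _ (Hlim a))). }
  (* The balls are closed, so the coordinatewise limit stays in each of them. *)
  assert (HcB : forall n, Ball r N (b n) (h n) (e n) c).
  { intros n a Ha. apply (Un_cv_dist_le (fun n => b n a) _ _ _ n); [now apply Hc|].
    intros m Hm. now apply Hin. }
  assert (HcL : InLambda r N c).
  (* As soon as the weight is below [g], the limit is within finite [g]-distance of the centre
     [b (S n)], which lies in the space. *)
  { intros g Hg. destruct (inv_INR_small g Hg) as [n Hn].
    assert (Hnn := Hn n (Nat.le_refl n)).
    destruct (Hpos (S n)) as [P1 [P2 P3]]. destruct (Hst n) as [_ [S2 _]].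
    destruct (P1 g Hg) as [C HC]. exists (e (S n) + C). intros a Ha.
    assert (G1 := HC a Ha).
    assert (G2 : Ball r N (b (S n)) g (e (S n)) c).
    { eapply Ball_weaken; [assumption|..|apply (HcB (S n))]; lra. }
    assert (G3 := G2 a Ha).
    replace (c a) with ((c a - b (S n) a) + b (S n) a) by ring.
    eapply Rle_trans; [apply Rabs_triang|]. lra. }
  exists c. split; [assumption|]. split.
  - intros n. destruct (Hst n) as [_ [_ [_ [_ [_ S6]]]]]. now apply S6.
  - rewrite <- Eb, <- Eh, <- Ee. apply HcB.
Qed.

(** * Meagerness and density *)

Lemma WeightSeq_LogConvex (M : nat -> R) : WeightSeq M -> LogConvex M.
Proof.
  intros [_ [_ [_ [H _]]]] p. assert (G := H (S p) ltac:(lia)).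
  replace (S p - 1)%nat with p in G by lia.
  replace (S p + 1)%nat with (S (S p)) in G by lia. lra.
Qed.

Theorem mainTheorem4 (r : nat) (M N : nat -> R) :
  (1 <= r)%nat ->
  WeightSeq M -> Quasianalytic M ->
  WeightSeq N -> Quasianalytic N ->
  (forall B, exists K, forall k, (K <= k)%nat -> (1 <= k)%nat ->
      B < Rpower (small N k) (/ INR k)) ->
  (exists O : nat -> MSeq -> Prop,
     (forall n, LOpen r N (O n) /\ LDense r N (O n)) /\
     forall b, InLambda r N b -> (forall n, O n b) ->
       ~ BorelImageRoumieu r M b) /\
  (forall b, InLambda r N b -> forall h eps, 0 < h -> 0 < eps ->
     exists c, InLambda r N c /\ ~ BorelImageRoumieu r M c /\ Ball r N b h eps c).
Proof.
  intros Hr HM HMq HN _ Hroot.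
  assert (HMc := WeightSeq_LogConvex M HM).
  destruct HM as [HMp _]. destruct HN as [HNp _].
  set (O := fun n => AwayFrom r N (AxisJetN M n)).
  assert (HO : forall n, LOpen r N (O n) /\ LDense r N (O n)).
  { intros n. split; [apply AwayFrom_open|now apply AwayFrom_AxisJetN_dense]. }
  assert (Hout : forall b, InLambda r N b -> (forall n, O n b) ->
            ~ BorelImageRoumieu r M b).
  (* A jet in the image lies in some [AxisJetN M n], yet it is the centre of a ball that avoids this
     set. *)
  { intros b Hb HOb Him.
    destruct (BorelImageRoumieu_AxisJetN r M b Hr HMp Him) as [n Hn].
    destruct (HOb n) as [h [eps [Hh [He H]]]].
    exact (H b Hb (Ball_center r N b h eps HNp Hh He) Hn). }
  split; [now exists O|].
  intros b Hb h eps Hh He.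
  destruct (Lambda_Baire r N O HNp HO b Hb h eps Hh He) as [c [Hc [HOc Hbc]]].
  exists c. auto.
Qed.
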